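(* Let $R$ be a commutative ring with identity, $A$ a commutative $R$-algebra with identity, and $f$ an averaging operator on $A$. Then the $R$-module $A$ becomes a Lie algebra under the bracket operation $[x,y]_f=xf(y)-yf(x)$, $x,y\in A$.
   Context: An averaging operator on $A$ is an $R$-module endomorphism $f:A\to A$ with $f(xf(y))=f(x)f(y)$ for all $x,y\in A$. A Lie bracket operation on an $R$-module $A$ is an $R$-bilinear operation $[,]:A\times A\to A$ with $[x,x]=0$ for all $x\in A$ and $[[x,y],z]+[[y,z],x]+[[z,x],y]=0$ for all $x,y,z\in A$; the pair $(A,[,])$ is then called a Lie algebra. *)

(* Defs.v *)
From HB Require Import structures.
From mathcomp Require Import all_boot all_algebra.

Set Implicit Arguments.
Unset Strict Implicit.
Unset Printing Implicit Defensive.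

Import GRing.Theory.
Local Open Scope ring_scope.

(* The library's comAlgType extends comNzRingType, which requires 1 != 0. This *)
(* is its counterpart over comPzRingType, so that the zero ring is allowed as  *)
(* an algebra: a commutative ring that is also an R-module, with compatible    *)
(* scaling. By commutativity, a *: (x * y) = x * (a *: y) follows.             *)
(* It is a plain record because HB rejects a structure that joins pzRingType   *)
(* and lmodType once the nonzero algebra hierarchy has been declared.          *)
Record comPzAlgType (R : comPzRingType) := ComPzAlgType {
  alg_ring : comPzRingType;
  alg_lmod : GRing.Zmodule_isLmodule R alg_ring;
  alg_scaleAl : forall (a : R) (x y : alg_ring),
    GRing.Zmodule_isLmodule.scale alg_lmod a (x * y) =
    GRing.Zmodule_isLmodule.scale alg_lmod a x * y
}.

Definition alg_sort (R : comPzRingType) (A : comPzAlgType R) : Type :=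
  alg_ring A.
Coercion alg_sort : comPzAlgType >-> Sortclass.

HB.instance Definition _ (R : comPzRingType) (A : comPzAlgType R) :=
  GRing.ComPzRing.copy (alg_sort A) (alg_ring A).
HB.instance Definition _ (R : comPzRingType) (A : comPzAlgType R) :
  GRing.Zmodule_isLmodule R (alg_sort A) := alg_lmod A.

Lemma pz_scalerAl (R : comPzRingType) (A : comPzAlgType R)
    (a : R) (x y : A) : a *: (x * y) = (a *: x) * y.
Proof. exact: alg_scaleAl. Qed.

Definition is_averaging_operator (R : comPzRingType) (A : comPzAlgType R)
    (f : {linear A -> A}) : Prop :=
  forall x y : A, f (x * f y) = f x * f y.

Record is_lie_bracket (R : comPzRingType) (A : lmodType R)
    (br : A -> A -> A) : Prop := IsLieBracket {
  lie_linearl : forall y : A, linear (br ^~ y);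
  lie_linearr : forall x : A, linear (br x);
  lie_alternating : forall x : A, br x x = 0;
  lie_jacobi : forall x y z : A,
    br (br x y) z + br (br y z) x + br (br z x) y = 0
}.

Definition averaging_bracket (R : comPzRingType) (A : comPzAlgType R)
    (f : {linear A -> A}) (x y : A) : A :=
  x * f y - y * f x.

(* Main.v *)
Require Import Defs.
From HB Require Import structures.
From mathcomp Require Import all_boot all_algebra.
From mathcomp Require Import ring.

(** The averaging identity and commutativity give f [x, y]_f = 0, so that
    [[x, y]_f, z]_f = (x f y - y f x) f z, and the cyclic sum cancels. *)

Import GRing.Theory.
Local Open Scope ring_scope.

(** Since [f (x * f y) = f x * f y] is symmetric in [x] and [y], [f] kills every bracket
    ([averaging_bracket_ker]). A nested bracket thus loses one of its two terms, and the Jacobi sum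
    expands into six monomials of the shape [x * f y * f z], cancelling in pairs. Bilinearity comes
    from that of the product and the linearity of [f]. *)

Lemma averaging_bracketC (R : comPzRingType) (A : comPzAlgType R)
    (f : {linear A -> A}) (x y : A) :
  averaging_bracket f x y = - averaging_bracket f y x.
Proof. by rewrite /averaging_bracket opprB. Qed.

Lemma averaging_bracket_linearl (R : comPzRingType) (A : comPzAlgType R)
    (f : {linear A -> A}) (y : A) :
  linear (fun x => averaging_bracket f x y).
Proof.
move=> a u v; rewrite /averaging_bracket linearP mulrDl mulrDr -pz_scalerAl.
by rewrite [y * (a *: _)]mulrC -pz_scalerAl [f u * y]mulrC opprD addrACA scalerBr.
Qed.

(** Antisymmetry transports linearity from the left argument. *)
Lemma averaging_bracket_linearr (R : comPzRingType) (A : comPzAlgType R)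
    (f : {linear A -> A}) (x : A) :
  linear (averaging_bracket f x).
Proof.
move=> a u v; rewrite averaging_bracketC averaging_bracket_linearl opprD -scalerN.
by rewrite -!averaging_bracketC.
Qed.

Lemma averaging_bracket_ker (R : comPzRingType) (A : comPzAlgType R)
    (f : {linear A -> A}) (f_avg : is_averaging_operator f) (x y : A) :
  f (averaging_bracket f x y) = 0.
Proof. by rewrite /averaging_bracket raddfB /= !f_avg mulrC subrr. Qed.

Theorem theorem4p2 (R : comPzRingType) (A : comPzAlgType R)
    (f : {linear A -> A}) (f_avg : is_averaging_operator f) :
  is_lie_bracket (averaging_bracket f).
Proof.
split=> [y|x|x|x y z].
- exact: averaging_bracket_linearl.
- exact: averaging_bracket_linearr.
- exact: subrr.
have bracket2 u v w : averaging_bracket f (averaging_bracket f u v) w =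
    (u * f v - v * f u) * f w.
  by rewrite {1}/averaging_bracket averaging_bracket_ker // mulr0 subr0.
(* No [f] is now applied to a compound term, so [f x], [f y], [f z] act as independent atoms and a
   commutative ring identity remains. *)
rewrite !bracket2; ring.
Qed.
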